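(* The Baer radical exists in the variety of Novikov algebras over a field $F$; that is, there exists a radical $\mathcal{R}$ on the class of all Novikov algebras over $F$ whose class of $\mathcal{R}$-semisimple algebras is exactly the class of all semiprime Novikov algebras over $F$.
   Context: Algebras are (not necessarily associative, not necessarily unital) algebras over a field $F$. Write $(a,b,c)=(ab)c-a(bc)$. A Novikov algebra is an algebra satisfying the identities $(a,b,c)=(b,a,c)$ and $(ab)c=(ac)b$. ''Ideal'' means two-sided ideal; $I^2$ is the linear span of all products $xy$ with $x,y\in I$. An algebra $A$ is semiprime if for any ideal $I$ of $A$, $I^2=0$ implies $I=0$. A radical (in the sense of Kurosh) on a class $\mathcal{K}$ of algebras closed under ideals and homomorphic images is a subclass $\mathcal{R}\subseteq\mathcal{K}$ (closed under isomorphism) such that: (A) every homomorphic image of an algebra in $\mathcal{R}$ is in $\mathcal{R}$; (B) every algebra $A\in\mathcal{K}$ has an ideal $\mathcal{R}(A)$ that belongs to $\mathcal{R}$ (as an algebra) and contains every ideal of $A$ belonging to $\mathcal{R}$; (C) the quotient $A/\mathcal{R}(A)$ has no nonzero ideals belonging to $\mathcal{R}$. An algebra $A\in\mathcal{K}$ is $\mathcal{R}$-semisimple if $\mathcal{R}(A)=0$. The Baer radical on $\mathcal{K}$ is the radical whose semisimple class is the class of semiprime algebras of $\mathcal{K}$. *)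

(* Defs.v *)
From HB Require Import structures.
From mathcomp Require Import all_boot all_algebra.
From mathcomp Require Import boolp classical_sets.

Set Implicit Arguments.
Unset Strict Implicit.
Unset Printing Implicit Defensive.

Import GRing.Theory.

Local Open Scope ring_scope.
Local Open Scope classical_set_scope.

(* Algebras that need be neither associative nor unital; no restriction on the
   dimension. *)
HB.mixin Record Lmodule_isNonAssocAlgebra (F : fieldType) A
    of GRing.Lmodule F A := {
  namul : A -> A -> A;
  namulDl : forall x y z, namul (x + y) z = namul x z + namul y z;
  namulDr : forall x y z, namul x (y + z) = namul x y + namul x z;
  namulZl : forall (c : F) x y, namul (c *: x) y = c *: namul x y;
  namulZr : forall (c : F) x y, namul x (c *: y) = c *: namul x y
}.

#[short(type="naAlgType")]
HB.structure Definition NonAssocAlgebra (F : fieldType) :=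
  {A of Lmodule_isNonAssocAlgebra F A & GRing.Lmodule F A}.

Notation "x ** y" := (namul x y) (at level 40, left associativity) : ring_scope.

Section Basics.
Variables (F : fieldType) (A : naAlgType F).
Implicit Types x y z : A.

Definition associator x y z : A := (x ** y) ** z - x ** (y ** z).

Lemma namul0l x : 0 ** x = 0.
Proof. by rewrite -[X in X ** x](scale0r (0 : A)) namulZl scale0r. Qed.

Lemma namul0r x : x ** 0 = 0.
Proof. by rewrite -[X in x ** X](scale0r (0 : A)) namulZr scale0r. Qed.

Lemma namulNl x y : (- x) ** y = - (x ** y).
Proof. by rewrite -scaleN1r namulZl scaleN1r. Qed.

Lemma namulNr x y : x ** (- y) = - (x ** y).
Proof. by rewrite -scaleN1r namulZr scaleN1r. Qed.

Lemma namulBl x y z : (x - y) ** z = x ** z - y ** z.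
Proof. by rewrite namulDl namulNl. Qed.

Lemma namulBr x y z : x ** (y - z) = x ** y - x ** z.
Proof. by rewrite namulDr namulNr. Qed.

Record ideal : Type := Ideal {
  ideal_set :> set A;
  ideal0 : ideal_set 0;
  idealD : forall x y, ideal_set x -> ideal_set y -> ideal_set (x + y);
  idealZ : forall (c : F) x, ideal_set x -> ideal_set (c *: x);
  idealMl : forall x y, ideal_set y -> ideal_set (x ** y);
  idealMr : forall x y, ideal_set x -> ideal_set (x ** y)
}.

Definition lin_span (X : set A) : set A :=
  [set v | exists2 s : seq (F * A),
     forall p, p \in s -> X p.2 & v = \sum_(p <- s) p.1 *: p.2].

Definition ideal_sq (I : ideal) : set A :=
  lin_span [set x ** y | x in I & y in I].

Definition semiprime : Prop :=
  forall I : ideal, ideal_sq I = [set 0] -> I = [set 0] :> set A.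

End Basics.

(* An ideal as an algebra in its own right, with the operations of A. *)
Section IdealAlgebra.
Variables (F : fieldType) (A : naAlgType F) (I : ideal A).

Definition ideal_pred : A -> bool := fun x => `[< ideal_set I x >].

Lemma ideal_predP x : reflect (ideal_set I x) (ideal_pred x).
Proof. exact: asboolP. Qed.

Lemma ideal_pred_submod : submod_closed ideal_pred.
Proof.
split=> [|c x y /ideal_predP Ix /ideal_predP Iy]; apply/ideal_predP.
  exact: ideal0.
by apply: idealD => //; apply: idealZ.
Qed.

HB.instance Definition _ :=
  GRing.isSubmodClosed.Build F A ideal_pred ideal_pred_submod.

Definition ideal_alg : Type := {x : A | ideal_pred x}.

HB.instance Definition _ := SubChoice.on ideal_alg.
HB.instance Definition _ := [SubChoice_isSubLmodule of ideal_alg by <:].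

Lemma ideal_alg_mul_subproof (u v : ideal_alg) : ideal_pred (val u ** val v).
Proof. by apply/ideal_predP/idealMl/ideal_predP/(valP v). Qed.

Definition ideal_alg_mul (u v : ideal_alg) : ideal_alg :=
  Sub (val u ** val v) (ideal_alg_mul_subproof u v).

Lemma ideal_alg_mulDl u v w :
  ideal_alg_mul (u + v) w = ideal_alg_mul u w + ideal_alg_mul v w.
Proof. by apply: val_inj; rewrite !(SubK, raddfD) /= namulDl. Qed.

Lemma ideal_alg_mulDr u v w :
  ideal_alg_mul u (v + w) = ideal_alg_mul u v + ideal_alg_mul u w.
Proof. by apply: val_inj; rewrite !(SubK, raddfD) /= namulDr. Qed.

Lemma ideal_alg_mulZl (c : F) u v :
  ideal_alg_mul (c *: u) v = c *: ideal_alg_mul u v.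
Proof. by apply: val_inj; rewrite !(SubK, linearZ) /= namulZl. Qed.

Lemma ideal_alg_mulZr (c : F) u v :
  ideal_alg_mul u (c *: v) = c *: ideal_alg_mul u v.
Proof. by apply: val_inj; rewrite !(SubK, linearZ) /= namulZr. Qed.

HB.instance Definition _ := Lmodule_isNonAssocAlgebra.Build F ideal_alg
  ideal_alg_mulDl ideal_alg_mulDr ideal_alg_mulZl ideal_alg_mulZr.

End IdealAlgebra.

(* The quotient algebra A / I, on top of the library's quotient of a
   zmodType by an additive subgroup. *)
Section QuotientAlgebra.
Variables (F : fieldType) (A : naAlgType F) (I : ideal A).

Local Open Scope quotient_scope.

Definition quot_zmodClosed : zmodClosed A :=
  GRing.ZmodClosed.clone A (ideal_pred I) _.

Definition quot_alg : Type := Quotient.quot quot_zmodClosed.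

HB.instance Definition _ := GRing.Zmodule.on quot_alg.

Definition quot_pi (x : A) : quot_alg := \pi_(Quotient.quot quot_zmodClosed) x.

Lemma quot_pi_eqP x y : quot_pi x = quot_pi y <-> ideal_set I (x - y).
Proof.
split=> [/eqP|/ideal_predP Ixy].
  by rewrite /quot_pi -Quotient.idealrBE => /ideal_predP.
by apply/eqP; rewrite /quot_pi -Quotient.idealrBE.
Qed.

Lemma quot_piD x y : quot_pi (x + y) = quot_pi x + quot_pi y.
Proof. by rewrite /quot_pi raddfD. Qed.

Lemma quot_piK (u : quot_alg) : quot_pi (repr u) = u.
Proof. exact: reprK. Qed.

Definition quot_scale (c : F) (u : quot_alg) : quot_alg :=
  quot_pi (c *: repr u).

Definition quot_mul (u v : quot_alg) : quot_alg := quot_pi (repr u ** repr v).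

Lemma quot_piZ c x : quot_scale c (quot_pi x) = quot_pi (c *: x).
Proof.
apply/quot_pi_eqP; rewrite -scalerBr; apply: idealZ.
by apply/quot_pi_eqP; rewrite quot_piK.
Qed.

Lemma quot_piM x y : quot_mul (quot_pi x) (quot_pi y) = quot_pi (x ** y).
Proof.
set x' := repr (quot_pi x); set y' := repr (quot_pi y).
have Ix : ideal_set I (x' - x) by apply/quot_pi_eqP; rewrite quot_piK.
have Iy : ideal_set I (y' - y) by apply/quot_pi_eqP; rewrite quot_piK.
apply/quot_pi_eqP; rewrite -/x' -/y'.
have -> : x' ** y' - x ** y = (x' - x) ** y' + x ** (y' - y).
  by rewrite namulBl namulBr addrA subrK.
by apply: idealD; [apply: idealMr | apply: idealMl].
Qed.

Lemma quot_scaleA c d u : quot_scale c (quot_scale d u) = quot_scale (c * d) u.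
Proof. by rewrite -[u]quot_piK !quot_piZ scalerA. Qed.

Lemma quot_scale1 : left_id 1 quot_scale.
Proof. by move=> u; rewrite -[u]quot_piK quot_piZ scale1r. Qed.

Lemma quot_scaleDr : right_distributive quot_scale +%R.
Proof.
move=> c u v; rewrite -[u]quot_piK -[v]quot_piK.
by rewrite -quot_piD !quot_piZ scalerDr quot_piD.
Qed.

Lemma quot_scaleDl u : {morph quot_scale^~ u : c d / c + d}.
Proof.
by move=> c d; rewrite -[u]quot_piK !quot_piZ scalerDl quot_piD.
Qed.

HB.instance Definition _ := GRing.Zmodule_isLmodule.Build F quot_alg
  quot_scaleA quot_scale1 quot_scaleDr quot_scaleDl.

Lemma quot_mulDl u v w : quot_mul (u + v) w = quot_mul u w + quot_mul v w.
Proof.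
rewrite -[u]quot_piK -[v]quot_piK -[w]quot_piK.
by rewrite -quot_piD !quot_piM namulDl quot_piD.
Qed.

Lemma quot_mulDr u v w : quot_mul u (v + w) = quot_mul u v + quot_mul u w.
Proof.
rewrite -[u]quot_piK -[v]quot_piK -[w]quot_piK.
by rewrite -quot_piD !quot_piM namulDr quot_piD.
Qed.

Lemma quot_mulZl (c : F) u v : quot_mul (c *: u) v = c *: quot_mul u v.
Proof.
rewrite -[u]quot_piK -[v]quot_piK quot_piM.
have quot_scaleE x : c *: quot_pi x = quot_pi (c *: x) := quot_piZ c x.
by rewrite !quot_scaleE quot_piM namulZl.
Qed.

Lemma quot_mulZr (c : F) u v : quot_mul u (c *: v) = c *: quot_mul u v.
Proof.
rewrite -[u]quot_piK -[v]quot_piK quot_piM.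
have quot_scaleE x : c *: quot_pi x = quot_pi (c *: x) := quot_piZ c x.
by rewrite !quot_scaleE quot_piM namulZr.
Qed.

HB.instance Definition _ := Lmodule_isNonAssocAlgebra.Build F quot_alg
  quot_mulDl quot_mulDr quot_mulZl quot_mulZr.

End QuotientAlgebra.

Section Radicals.
Variable F : fieldType.
Implicit Types (A B : naAlgType F) (R : naAlgType F -> Prop).

Definition alg_morphism A B (f : {linear A -> B}) : Prop :=
  {morph f : x y / x ** y >-> x ** y}.

Definition homomorphic_image A B : Prop :=
  exists2 f : {linear A -> B}, alg_morphism f & forall b, exists a, f a = b.

Definition alg_isomorphic A B : Prop :=
  exists2 f : {linear A -> B}, alg_morphism f & bijective f.

Record alg_class : Type := AlgClass {
  in_class :> naAlgType F -> Prop;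
  class_ideal : forall A (I : ideal A), in_class A -> in_class (ideal_alg I);
  class_image : forall A B, homomorphic_image A B -> in_class A -> in_class B
}.

(* I is the ideal R(A); it is unique when it exists. *)
Definition is_radical_of R A (I : ideal A) : Prop :=
  R (ideal_alg I) /\ forall J : ideal A, R (ideal_alg J) -> J `<=` I.

Record kurosh_radical (K : alg_class) R : Prop := KuroshRadical {
  radical_sub : forall A, R A -> K A;
  radical_iso : forall A B, alg_isomorphic A B -> R A -> R B;
  radical_image : forall A B, homomorphic_image A B -> R A -> R B;
  radical_exists : forall A, K A -> exists I : ideal A, is_radical_of R I;
  radical_quot : forall A (I : ideal A), K A -> is_radical_of R I ->
    forall J : ideal (quot_alg I), R (ideal_alg J) ->
      J = [set 0] :> set (quot_alg I)
}.

Definition semisimple R A : Prop :=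
  exists2 I : ideal A, is_radical_of R I & I = [set 0] :> set A.

Definition baer_radical (K : alg_class) R : Prop :=
  kurosh_radical K R /\
  forall A, (K A /\ semisimple R A) <-> (K A /\ semiprime A).

Definition is_novikov A : Prop :=
  (forall a b c : A, associator a b c = associator b a c) /\
  (forall a b c : A, (a ** b) ** c = (a ** c) ** b).

Lemma novikov_ideal A (I : ideal A) : is_novikov A -> is_novikov (ideal_alg I).
Proof.
case=> assocC mulAC; split=> u v w; apply: val_inj; last exact: mulAC.
by rewrite /associator !raddfB; apply: assocC.
Qed.

Lemma novikov_image A B : homomorphic_image A B -> is_novikov A -> is_novikov B.
Proof.
case=> f fM f_surj [assocC mulAC].
split=> u v w; have [x <-] := f_surj u; have [y <-] := f_surj v;
  have [z <-] := f_surj w.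
  by rewrite /associator -!fM -!raddfB; congr (f _); apply: assocC.
by rewrite -!fM; congr (f _); apply: mulAC.
Qed.

Definition novikov_class : alg_class := AlgClass novikov_ideal novikov_image.

End Radicals.

(* Main.v *)
From HB Require Import structures.
From mathcomp Require Import all_boot all_algebra.
From mathcomp Require Import boolp classical_sets.
Require Import Defs.

(* The radical is the upper radical of the semiprime class: the algebras without
   nonzero semiprime homomorphic image. Everything reduces to showing that an
   ideal I of a semiprime Novikov algebra A is semiprime. Let J be an ideal of I
   with J^2 = 0. If K is an ideal of A, so is its left annihilator, whence x = 0
   as soon as x is in K and xK = 0. Applied to K = I, this shows that
   P = {x | Jx = 0} is a left ideal of A. Then the largest right ideal of A
   inside P is an ideal of A, annihilated on the left by J; so if it contains J,
   then J = 0. This argument first kills the largest right ideal of A inside J,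
   which contains IJ since right multiplications commute. From IJ = 0 one gets
   AJ = 0 and J(JA) = 0, hence the right ideal generated by J lies in P, and the
   argument applies to J itself. *)

Set Implicit Arguments.
Unset Strict Implicit.
Unset Printing Implicit Defensive.

Import GRing.Theory.

Local Open Scope ring_scope.
Local Open Scope classical_set_scope.

(** * Semiprimeness on elements, and elements of an ideal *)

Lemma semiprimeP (F : fieldType) (A : naAlgType F) :
  semiprime A <-> forall I : ideal A,
    (forall x y, ideal_set I x -> ideal_set I y -> x ** y = 0) ->
    forall x, ideal_set I x -> x = 0.
Proof.
split=> [prA I I2 x Ix | prA I sqI].
  have I0 : I = [set 0] :> set A.
    apply: prA; apply/seteqP; split=> [v [s sI ->]|v ->].
      rewrite /= big1_seq // => p /= /sI [y Iy [z Iz <-]].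
      by rewrite I2 ?scaler0.
    by exists [::] => //; rewrite big_nil.
  by move: Ix; rewrite I0.
apply/seteqP; split=> x; last by move=> ->; apply: ideal0.
apply: prA => y z Iy Iz; suff: ideal_sq I (y ** z) by rewrite sqI.
exists [:: (1, y ** z)]; last by rewrite big_seq1 scale1r.
by move=> p; rewrite inE => /eqP ->; exists y => //; exists z.
Qed.

Section IdealElements.
Variables (F : fieldType) (A : naAlgType F) (I : ideal A).

Lemma ideal_val_mem (u : ideal_alg I) : ideal_set I (val u).
Proof. exact/ideal_predP/(valP u). Qed.

Definition ideal_elt x (Ix : ideal_set I x) : ideal_alg I :=
  Sub x (introT (ideal_predP I x) Ix).

Lemma ideal_elt_linear (L : lmodType F) (f : L -> A)
    (If : forall u, ideal_set I (f u)) :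
  linear f -> linear (fun u => ideal_elt (If u)).
Proof.
by move=> lin_f k u v; apply: val_inj; rewrite linearP; apply: lin_f.
Qed.

End IdealElements.

(** * Ideals of a semiprime Novikov algebra are semiprime *)

Section Novikov.
Variables (F : fieldType) (A : naAlgType F).
Hypothesis novA : is_novikov A.
Implicit Types (a b c x y : A) (X : set A) (I : ideal A).

Lemma novikov_mulAC a b c : a ** b ** c = a ** c ** b.
Proof. by case: novA. Qed.

Lemma novikov_mulCA a b c :
  a ** (b ** c) = a ** b ** c - b ** a ** c + b ** (a ** c).
Proof.
have [assocC _] := novA; have := assocC b a c.
rewrite /associator => /eqP; rewrite subr_eq => /eqP ->.
by rewrite opprD opprB addrA subrK addrC subrK.
Qed.

Lemma foldl_namulDl x y s :
  foldl namul (x + y) s = foldl namul x s + foldl namul y s.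
Proof. by elim: s x y => //= a s IHs x y; rewrite namulDl IHs. Qed.

Lemma foldl_namulZl (k : F) x s :
  foldl namul (k *: x) s = k *: foldl namul x s.
Proof. by elim: s x => //= a s IHs x; rewrite namulZl IHs. Qed.

Lemma foldl_namul0l s : foldl namul (0 : A) s = 0.
Proof. by elim: s => //= a s; rewrite namul0l. Qed.

Lemma foldl_namulAC x y s : foldl namul x s ** y = foldl namul (x ** y) s.
Proof. by elim: s x => //= a s IHs x; rewrite IHs novikov_mulAC. Qed.

Lemma ideal_foldl I x s : ideal_set I x -> ideal_set I (foldl namul x s).
Proof. by elim: s x => //= a s IHs x Ix; apply/IHs/idealMr. Qed.

(** For a linear subspace [X], this is the largest right ideal of [A] inside [X]; the empty list
    gives membership in [X]. *)
Definition right_core X : set A := [set x | forall s, X (foldl namul x s)].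

Definition right_annihilator X : set A := [set x | forall y, X y -> y ** x = 0].

Section LeftAnnihilator.
Variable I : ideal A.

Definition left_annihilator : set A :=
  [set x | forall y, ideal_set I y -> x ** y = 0].

Lemma left_annihilator0 : left_annihilator 0.
Proof. by move=> y _; rewrite namul0l. Qed.

Lemma left_annihilatorD x y :
  left_annihilator x -> left_annihilator y -> left_annihilator (x + y).
Proof. by move=> Ix Iy z Iz; rewrite namulDl Ix ?Iy ?addr0. Qed.

Lemma left_annihilatorZ (k : F) x :
  left_annihilator x -> left_annihilator (k *: x).
Proof. by move=> Ix z Iz; rewrite namulZl Ix ?scaler0. Qed.

Lemma left_annihilatorMr x y :
  left_annihilator x -> left_annihilator (x ** y).
Proof. by move=> Ix z Iz; rewrite novikov_mulAC Ix ?namul0l. Qed.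

(** In x(yz) = (xy)z - (yx)z + y(xz) all terms but (xy)z vanish, since (yx)z = (yz)x and xz lies in
    I. *)
Lemma left_annihilatorMl x y :
  left_annihilator y -> left_annihilator (x ** y).
Proof.
move=> Iy z Iz; have := novikov_mulCA x y z.
rewrite (novikov_mulAC y) (Iy z Iz) (Iy (x ** z)); last exact: idealMl.
by rewrite namul0r namul0l subr0 addr0.
Qed.

Definition annihilator_meet : ideal A.
Proof.
apply: (@Ideal _ A [set x | ideal_set I x /\ left_annihilator x]) => /=.
- by split; [apply: ideal0 | apply: left_annihilator0].
- move=> x y [Ix x0] [Iy y0]; split; first exact: idealD.
  exact: left_annihilatorD.
- by move=> k x [Ix x0]; split; [apply: idealZ | apply: left_annihilatorZ].
- by move=> x y [Iy y0]; split; [apply: idealMl | apply: left_annihilatorMl].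
- by move=> x y [Ix x0]; split; [apply: idealMr | apply: left_annihilatorMr].
Defined.

End LeftAnnihilator.

Hypothesis prA : semiprime A.

Lemma semiprime_left_annihilator I x :
  ideal_set I x -> left_annihilator I x -> x = 0.
Proof.
move=> Ix x0; apply: ((semiprimeP A).1 prA (annihilator_meet I)) => //.
by move=> y z [_ y0] [Iz _]; apply: y0.
Qed.

Section LeftStableSubset.
Variables (I : ideal A) (J : set A).
Hypothesis JI : J `<=` I.
Hypothesis IJ : forall i j, ideal_set I i -> J j -> J (i ** j).

(** In j(ax) = (ja)x - (aj)x + a(jx) only (aj)x is in doubt. It lies in I and annihilates I:
    ((aj)x)i = ((ai)j)x, where (ai)j is in J. *)
Lemma right_annihilatorMl a x :
  right_annihilator J x -> right_annihilator J (a ** x).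
Proof.
move=> Jx j Jj; have Ij := JI Jj.
have ajx : a ** j ** x = 0.
  apply: (@semiprime_left_annihilator I); first exact/idealMr/idealMl.
  move=> i Ii; rewrite novikov_mulAC (novikov_mulAC a) Jx //.
  by apply: IJ => //; apply: idealMl.
by rewrite novikov_mulCA novikov_mulAC Jx // ajx namul0l namul0r subr0 addr0.
Qed.

Definition annihilator_core : ideal A.
Proof.
apply: (@Ideal _ A (right_core (right_annihilator J))) => /=.
- by move=> s j Jj; rewrite foldl_namul0l namul0r.
- by move=> x y Px Py s j Jj; rewrite foldl_namulDl namulDr Px ?Py ?addr0.
- by move=> k x Px s j Jj; rewrite foldl_namulZl namulZr Px ?scaler0.
- move=> a x Px s; elim: s x Px => [|b s IHs] x Px.
    exact/right_annihilatorMl/(Px [::]).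
  move=> j Jj /=.
  (* By left symmetry, the first term falls to the induction hypothesis at [x ** b]; the other two
     are right multiples of [x]. *)
  have -> : a ** x ** b = a ** (x ** b) + x ** a ** b - x ** (a ** b).
    by rewrite novikov_mulCA [_ - _ + _]addrAC subrK addrK.
  rewrite !foldl_namulDl -scaleN1r foldl_namulZl !namulDr namulZr.
  rewrite IHs //; last by move=> t; apply: (Px (b :: t)).
  by rewrite (Px (a :: b :: s)) // (Px (a ** b :: s)) // scaler0 !addr0.
- by move=> x a Px s; apply: (Px (a :: s)).
Defined.

(** [J] lies in the ideal [annihilator_core] and annihilates it on the left. With [J] a mere subset,
    this serves for a right core as well as for an ideal of [I]. *)
Lemma sub_annihilator_core_eq0 :
  J `<=` annihilator_core -> forall j, J j -> j = 0.
Proof.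
move=> Jcore j Jj; apply: (@semiprime_left_annihilator annihilator_core).
  exact: Jcore.
by move=> y Py; apply: (Py [::]).
Qed.

End LeftStableSubset.

Section SquareZero.
Variables (I : ideal A) (J : set A).
Hypothesis JI : J `<=` I.
Hypothesis IJ : forall i j, ideal_set I i -> J j -> J (i ** j).
Hypothesis JIr : forall i j, ideal_set I i -> J j -> J (j ** i).
Hypothesis JJ : forall j j', J j -> J j' -> j ** j' = 0.

(** The core is stable under I on the left: multiplying ix on the right by a word s gives (is)x,
    which is in IJ. It lies in its own annihilator core because JJ = 0. *)
Lemma right_core_square_zero j : right_core J j -> j = 0.
Proof.
have coreJ : right_core J `<=` J by move=> x Jx; apply: (Jx [::]).
apply: (@sub_annihilator_core_eq0 I) => [x /coreJ /JI//||].
  move=> i x Ii Jx s; rewrite -foldl_namulAC; apply: IJ; last exact: coreJ.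
  exact: ideal_foldl.
by move=> _ _ x Jx s y Jy; apply: JJ; [apply: coreJ | apply: Jx].
Qed.

Lemma mul_square_zero i j : ideal_set I i -> J j -> i ** j = 0.
Proof.
move=> Ii Jj; apply: right_core_square_zero => s.
rewrite -foldl_namulAC; apply: IJ => //.
exact: ideal_foldl.
Qed.

(** The element aj of I annihilates I, as (aj)i = (ai)j is in IJ = 0. *)
Lemma lmul_square_zero a j : J j -> a ** j = 0.
Proof.
move=> Jj; apply: (@semiprime_left_annihilator I); first exact/idealMl/JI.
move=> i Ii; rewrite novikov_mulAC mul_square_zero //; exact: idealMl.
Qed.

(** The associator (j,a,i) equals (a,j,i) = (aj)i - a(ji), where both terms are in AJ = 0. *)
Lemma rmul_square_zeroA j a i :
  J j -> ideal_set I i -> j ** a ** i = j ** (a ** i).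
Proof.
move=> Jj Ii; rewrite (novikov_mulCA j) (lmul_square_zero a Jj) namul0l subr0.
by rewrite (lmul_square_zero a (JIr Ii Jj)) addr0.
Qed.

(** Two reassociations give (j(j'a))i = j(j'(ai)), which is in JJ = 0. *)
Lemma mul_rmul_square_zero j j' a : J j -> J j' -> j ** (j' ** a) = 0.
Proof.
move=> Jj Jj'; apply: (@semiprime_left_annihilator I); first exact/idealMr/JI.
move=> i Ii; rewrite rmul_square_zeroA // rmul_square_zeroA //.
by rewrite lmul_square_zero //; apply/JIr/Jj'/idealMl.
Qed.

Lemma square_zero_eq0 j : J j -> j = 0.
Proof.
apply: (@sub_annihilator_core_eq0 I J) => // x Jx s; move: s.
apply: last_ind => [|s a IHs] y Jy; first exact: JJ.
(* With p for [foldl namul x s], y(pa) = (yp)a - (py)a + p(ya). Induction kills the first term and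
   AJ = 0 the second; the third is x(ya) multiplied by s, and J(JA) = 0. *)
rewrite foldl_rcons novikov_mulCA IHs // namul0l sub0r.
rewrite (lmul_square_zero _ Jy) namul0l oppr0 add0r.
by rewrite foldl_namulAC mul_rmul_square_zero // foldl_namul0l.
Qed.

End SquareZero.

Lemma semiprime_ideal_alg I : semiprime (ideal_alg I).
Proof.
apply/semiprimeP => J J2 u Ju; apply: val_inj; rewrite raddf0.
apply: (@square_zero_eq0 I
  [set x | exists2 v : ideal_alg I, ideal_set J v & val v = x]).
- by move=> _ [v _ <-]; apply: ideal_val_mem.
- move=> i _ Ii [v Jv <-].
  by exists (ideal_elt Ii ** v) => //; apply: idealMl.
- move=> i _ Ii [v Jv <-].
  by exists (v ** ideal_elt Ii) => //; apply: idealMr.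
- by move=> _ _ [v Jv <-] [w Jw <-]; rewrite -[LHS]/(val (v ** w)) J2.
by exists u.
Qed.

End Novikov.

(** * Homomorphic images and linear spans *)

Section Morphisms.
Variable F : fieldType.
Implicit Types A B C : naAlgType F.

Lemma linear_map (U V : lmodType F) (f : U -> V) :
  linear f -> {g : {linear U -> V} | g =1 f}.
Proof.
by move=> lin_f; exists (HB.pack_for {linear U -> V} f
  (GRing.isLinear.Build F U V *:%R f lin_f)).
Qed.

Lemma homomorphic_image_refl A : homomorphic_image A A.
Proof.
have [g gE] := linear_map (fun (k : F) (x y : A) => erefl (k *: x + y)).
by exists g => [x y|b]; [rewrite !gE | exists b; rewrite gE].
Qed.

Lemma homomorphic_image_trans A B C :
  homomorphic_image A B -> homomorphic_image B C -> homomorphic_image A C.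
Proof.
case=> f fM f_surj [g gM g_surj]; exists (g \o f) => [x y|c] /=.
  by rewrite fM gM.
by have [b <-] := g_surj c; have [a <-] := f_surj b; exists a.
Qed.

End Morphisms.

Section LinearSubsets.
Variables (F : fieldType) (U : lmodType F).

Definition linear_subset (T : set U) : Prop :=
  T 0 /\ forall (k : F) x y, T x -> T y -> T (k *: x + y).

Lemma smallest_linear_subset (X : set U) :
  linear_subset (smallest linear_subset X).
Proof.
split=> [T [[]]//|k x y Sx Sy T TX].
by have [[_ TP] _] := TX; apply: TP; [apply: Sx | apply: Sy].
Qed.

Lemma smallest_linear_closed (X : set U) (f : {linear U -> U}) :
  (forall x, X x -> X (f x)) ->
  forall x, smallest linear_subset X x -> smallest linear_subset X (f x).
Proof.
move=> Xf; have [S0 SP] := smallest_linear_subset X.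
apply: (@smallest_sub _ linear_subset X (f @^-1` smallest linear_subset X)).
  by split=> [|k x y Sx Sy] /=; rewrite ?raddf0 ?linearP //; apply: SP.
by move=> x Xx T [_ XT]; apply/XT/Xf.
Qed.

End LinearSubsets.

(** * The upper radical of the semiprime class *)

Section UpperRadical.
Variable F : fieldType.
Implicit Types A B C : naAlgType F.

Definition baer A : Prop :=
  is_novikov A /\
  (forall B, homomorphic_image A B -> semiprime B -> forall b : B, b = 0).

Lemma baer_image A B : homomorphic_image A B -> baer A -> baer B.
Proof.
move=> AB [novA trivA]; split=> [|C BC]; first exact: novikov_image AB novA.
exact/trivA/(homomorphic_image_trans AB).
Qed.

Lemma baer_semiprime_eq0 A : baer A -> semiprime A -> forall x : A, x = 0.
Proof. by case=> _ trivA; apply/trivA/homomorphic_image_refl. Qed.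

Lemma baer_square_zero A :
  is_novikov A -> (forall x y : A, x ** y = 0) -> baer A.
Proof.
move=> novA A2; split=> // B [f fM f_surj] prB b.
pose full : ideal B := @Ideal _ B setT I (fun _ _ _ _ => I) (fun _ _ _ => I)
  (fun _ _ _ => I) (fun _ _ _ => I).
apply: ((semiprimeP B).1 prB full) => // x y _ _.
by have [u <-] := f_surj x; have [v <-] := f_surj y; rewrite -fM A2 raddf0.
Qed.

(** The last two hypotheses make the range of [f] an ideal of [B]. It is then semiprime by
    [semiprime_ideal_alg], and it is an image of the Baer algebra [A]. *)
Lemma baer_morphism_eq0 A B (f : {linear A -> B}) :
    baer A -> is_novikov B -> semiprime B -> alg_morphism f ->
    (forall b x, exists y, f y = b ** f x) ->
    (forall b x, exists y, f y = f x ** b) ->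
  forall x, f x = 0.
Proof.
move=> baerA novB prB fM fMl fMr x.
have @im : ideal B.
  apply: (@Ideal _ B (range f)) => [|_ _ [y _ <-] [z _ <-]|k _ [y _ <-]||].
  - by exists 0; rewrite ?raddf0.
  - by exists (y + z); rewrite ?raddfD.
  - by exists (k *: y); rewrite ?linearZ.
  - by move=> b _ [y _ <-]; have [z <-] := fMl b y; exists z.
  - by move=> _ b [y _ <-]; have [z <-] := fMr b y; exists z.
have im_f y : ideal_set im (f y) by exists y.
have [g gE] := linear_map (ideal_elt_linear im_f (linearP f)).
have g_im : homomorphic_image A (ideal_alg im).
  exists g => [y z|u]; first by apply: val_inj; rewrite !gE /= fM.
  have [y _ fy] := ideal_val_mem u.
  by exists y; apply: val_inj; rewrite gE.
have -> : f x = val (g x) by rewrite gE.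
have prim := semiprime_ideal_alg novB prB (I := im).
by rewrite (baerA.2 _ g_im prim (g x)) raddf0.
Qed.

(** As [g] is onto and [J] is an ideal, [g] maps [J] onto an ideal of [C]; the previous lemma
    applies to [g] composed with the inclusion [i] of [J] in [S]. *)
Lemma baer_subideal_eq0 A (S J : ideal A) C (g : {linear ideal_alg S -> C}) :
    is_novikov A -> J `<=` S -> baer (ideal_alg J) -> semiprime C ->
    alg_morphism g -> (forall c, exists u, g u = c) ->
  forall u, ideal_set J (val u) -> g u = 0.
Proof.
move=> novA JS baerJ prC gM g_surj u Ju.
have SJ (v : ideal_alg J) : ideal_set S (val v) by apply/JS/ideal_val_mem.
have [i iE] := linear_map (ideal_elt_linear SJ (linearP val)).
have novC : is_novikov C.
  by apply: (@novikov_image _ (ideal_alg S)); [exists g | apply: novikov_ideal].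
have val_i v : val (i v) = val v by rewrite iE.
have -> : u = i (ideal_elt Ju) by apply: val_inj; rewrite val_i.
apply: (@baer_morphism_eq0 _ _ (g \o i)) => // [v w|c v|c v] /=.
- by rewrite -gM; congr (g _); apply: val_inj; rewrite val_i /= !val_i.
- have [w <-] := g_surj c; rewrite -gM.
  have Jwv : ideal_set J (val w ** val v) by apply/idealMl/ideal_val_mem.
  exists (ideal_elt Jwv); congr (g _).
  by apply: val_inj; rewrite val_i /= val_i.
have [w <-] := g_surj c; rewrite -gM.
have Jvw : ideal_set J (val v ** val w) by apply/idealMr/ideal_val_mem.
by exists (ideal_elt Jvw); congr (g _); apply: val_inj; rewrite val_i /= val_i.
Qed.

Section RadicalIdeal.
Variable A : naAlgType F.

Definition baer_elements : set A :=
  [set x | exists2 J : ideal A, baer (ideal_alg J) & ideal_set J x].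

Notation baer_span := (smallest (@linear_subset F A) baer_elements).

Lemma baer_spanMl a x : baer_span x -> baer_span (a ** x).
Proof.
have [f fE] : {f : {linear A -> A} | f =1 namul a}.
  by apply: linear_map => k y z; rewrite namulDr namulZr.
rewrite -fE; apply: smallest_linear_closed => y [J Jb Jy].
by exists J => //; rewrite fE; apply: idealMl.
Qed.

Lemma baer_spanMr x a : baer_span x -> baer_span (x ** a).
Proof.
have [f fE] : {f : {linear A -> A} | f =1 namul^~ a}.
  by apply: linear_map => k y z; rewrite namulDl namulZl.
rewrite -[x ** a]fE; apply: smallest_linear_closed => y [J Jb Jy].
by exists J => //; rewrite fE; apply: idealMr.
Qed.

Definition baer_ideal : ideal A.
Proof.
apply: (@Ideal _ A baer_span _ _ _ baer_spanMl baer_spanMr).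
- exact: (smallest_linear_subset baer_elements).1.
- move=> x y; rewrite -{2}[x]scale1r.
  exact: (smallest_linear_subset baer_elements).2.
move=> k x Sx; rewrite -[k *: x]addr0.
apply: (smallest_linear_subset baer_elements).2 => //.
exact: (smallest_linear_subset baer_elements).1.
Defined.

Lemma baer_idealP : is_novikov A -> is_radical_of baer baer_ideal.
Proof.
move=> novA.
have baer_sub (J : ideal A) : baer (ideal_alg J) -> J `<=` baer_ideal.
  by move=> Jb x Jx T [_ ST]; apply: ST; exists J.
split=> //; split=> [|C [g gM g_surj] prC c]; first exact: novikov_ideal.
suff g0 x (Sx : ideal_set baer_ideal x) : g (ideal_elt Sx) = 0.
  have [u <-] := g_surj c.
  by rewrite -(g0 _ (ideal_val_mem u)); congr (g _); apply: val_inj.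
have [S0 SP] := smallest_linear_subset baer_elements.
(* Quantifying over the membership proof turns the kernel of [g] into a linear subset of [A]; it
   remains to see that it contains every Baer ideal. *)
suff : baer_ideal `<=` [set x |
    exists Sx : ideal_set baer_ideal x, g (ideal_elt Sx) = 0].
  move=> /(_ x Sx) [Sx' <-]; congr (g _); exact: val_inj.
apply: smallest_sub => [|y [J Jb Jy]].
  split=> [|k y z [Sy gy] [Sz gz]].
    by exists S0; rewrite -[RHS](raddf0 g); congr (g _); apply: val_inj.
  have <- : g (k *: ideal_elt Sy + ideal_elt Sz) = 0.
    by rewrite linearP gy gz scaler0 addr0.
  by exists (SP k y z Sy Sz); congr (g _); apply: val_inj.
have Sy := baer_sub J Jb y Jy; exists Sy.
exact: (baer_subideal_eq0 novA (baer_sub J Jb) Jb prC gM g_surj).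
Qed.

End RadicalIdeal.

Lemma quot_pi0 A (I : ideal A) : quot_pi I 0 = 0.
Proof. by rewrite /quot_pi raddf0. Qed.

(** Closure under extensions: a map [g] from the preimage [J'] of [J] onto a semiprime algebra kills
    [I], hence factors through [J], which is Baer. *)
Lemma baer_extension A (I : ideal A) (J : ideal (quot_alg I)) :
    is_novikov A -> baer (ideal_alg I) -> baer (ideal_alg J) ->
  exists2 J' : ideal A, baer (ideal_alg J') &
    forall x, ideal_set J (quot_pi I x) -> ideal_set J' x.
Proof.
move=> novA baerI baerJ.
have piZ k x : quot_pi I (k *: x) = k *: quot_pi I x := esym (quot_piZ I k x).
have piM x y : quot_pi I (x ** y) = quot_pi I x ** quot_pi I y.
  exact/esym/quot_piM.
have @J' : ideal A.
  apply: (@Ideal _ A [set x | ideal_set J (quot_pi I x)]) => /=.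
  - by rewrite quot_pi0; apply: ideal0.
  - by move=> x y Jx Jy; rewrite quot_piD; apply: idealD.
  - by move=> k x Jx; rewrite piZ; apply: idealZ.
  - by move=> x y Jy; rewrite piM; apply: idealMl.
  - by move=> x y Jx; rewrite piM; apply: idealMr.
exists J' => //; split=> [|C [g gM g_surj] prC]; first exact: novikov_ideal.
have IJ' : I `<=` J'.
  move=> x Ix; have : quot_pi I x = 0.
    by rewrite -quot_pi0; apply/quot_pi_eqP; rewrite subr0.
  by move=> /= ->; apply: ideal0.
have g_pi u v : quot_pi I (val u) = quot_pi I (val v) -> g u = g v.
  move/quot_pi_eqP => Iuv; apply/eqP; rewrite -subr_eq0 -raddfB; apply/eqP.
  by apply: (baer_subideal_eq0 novA IJ' baerI prC gM g_surj); rewrite raddfB.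
have J'repr (w : ideal_alg J) : ideal_set J' (repr (val w)).
  by rewrite /= quot_piK; apply: ideal_val_mem.
(* The map induced by [g] on [J], computed on representatives; [g_pi] makes the choice
   irrelevant. *)
pose h w := g (ideal_elt (J'repr w)).
have hE w u : quot_pi I (val u) = val w -> h w = g u.
  by move=> uw; apply: g_pi; rewrite uw quot_piK.
have lin_h : linear h.
  move=> k v w; rewrite -linearP; apply: hE.
  by rewrite !(linearP val) quot_piD piZ !quot_piK.
have [h' h'E] := linear_map lin_h.
apply: baerJ.2 => //; exists h' => [v w|c].
  rewrite !h'E -gM; apply: hE.
  by rewrite /= piM !quot_piK.
have [u <-] := g_surj c; have Ju := ideal_val_mem u.
exists (ideal_elt (Ju : ideal_set J (quot_pi I (val u)))).
by rewrite h'E; apply: hE.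
Qed.

Lemma baer_kurosh : kurosh_radical (novikov_class F) baer.
Proof.
split=> [A []//|A B [f fM [g gK fK]]|A B|A novA|A I novA [baerI maxI] J baerJ].
- by apply: baer_image; exists f => // b; exists (g b).
- exact: baer_image.
- by exists (baer_ideal A); apply: baer_idealP.
have [J' baerJ' J'J] := baer_extension novA baerI baerJ.
apply/seteqP; split=> [u Ju|_ ->]; last exact: ideal0.
have Iu : ideal_set I (repr u) by apply/(maxI J' baerJ')/J'J; rewrite quot_piK.
by rewrite /= -[u]quot_piK -(quot_pi0 I); apply/quot_pi_eqP; rewrite subr0.
Qed.

(** Square-zero ideals are Baer, so they lie in the radical. Conversely, the radical of a semiprime
    algebra is both Baer and semiprime. *)
Lemma baer_semisimple A : is_novikov A -> semisimple baer A <-> semiprime A.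
Proof.
move=> novA; split=> [[I [baerI maxI] I0]|prA].
  apply/semiprimeP => J J2 x Jx; suff : ideal_set I x by rewrite I0.
  apply: (maxI J) => //; apply: baer_square_zero; first exact: novikov_ideal.
  by move=> u v; apply: val_inj; rewrite raddf0 /= J2 //; apply: ideal_val_mem.
have radA := baer_idealP novA; exists (baer_ideal A) => //.
apply/seteqP; split=> [x Ix|_ ->]; last exact: ideal0.
have prI := semiprime_ideal_alg novA prA (I := baer_ideal A).
rewrite /= -[x]/(val (ideal_elt Ix)).
by rewrite (baer_semiprime_eq0 radA.1 prI (ideal_elt Ix)) raddf0.
Qed.

End UpperRadical.

Theorem corollary1 (F : fieldType) :
  exists R : naAlgType F -> Prop, baer_radical (novikov_class F) R.
Proof.
exists (@baer F); split=> [|A]; first exact: baer_kurosh.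
by split=> -[novA /(baer_semisimple novA)].
Qed.
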